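(* Let $P(s)=\sum_{j=0}^{\mathsf d} s^j P_j$ with $P_j\in\mathbb C^{\mathsf n\times\mathsf n}$, $A\in\mathbb C^{\mathsf k\times\mathsf k}$, $B\in\mathbb C^{\mathsf k\times\mathsf n}$, $C\in\mathbb C^{\mathsf n\times\mathsf k}$, $R(s)=P(s)+C(sI_{\mathsf k}-A)^{-1}B$, and consider the iterates $\lambda_\ell$ and basis matrices $W_\ell,V_\ell$ of the subspace method described in the context with interpolation parameter $\mathsf q\ge2$. Let $\lambda_*$ be a simple eigenvalue of $R$ (i.e. $\eta_{\mathsf n}(\lambda_* )=0$ and $\eta_1(\lambda_* ),\dots,\eta_{\mathsf n-1}(\lambda_* )>0$) such that, for a given $\xi>0$, $\sigma_{\min}(A-\lambda_*I_{\mathsf k})\ge\xi$ and $\sigma_{\min}(W_\ell^*AV_\ell-\lambda_*W_\ell^*V_\ell)\ge\xi$, and suppose the Hessian $\nabla^2\eta_{\mathsf n}(\lambda_* )$ is invertible. Then, for consecutive iterates $\lambda_\ell,\lambda_{\ell+1}$ sufficiently close to $\lambda_*$, there exists a constant $C>0$ (independent of $\lambda_1,\dots,\lambda_\ell$ and of the subspaces spanned by $W_\ell,V_\ell$) such that $|\lambda_{\ell+1}-\lambda_*|\le C|\lambda_\ell-\lambda_*|^2$.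
   Context: Subspace method (for given $A,B,C,P$, integer $\mathsf q\ge 2$, target $\tau\in\mathbb C$): set $\lambda_0=\tau$. For $\ell=0,1,2,\dots$: form $\widetilde V_\ell=[(A-\lambda_\ell I)^{-1}B,\dots,(A-\lambda_\ell I)^{-\mathsf q}B]$ and $\widetilde W_\ell=[(A-\lambda_\ell I)^{-*}C^*,\dots,(A-\lambda_\ell I)^{-\mathsf q *}C^*]$ (here $X^{-j*}=((X^* )^{-1})^j$); let $V_0,W_0$ have orthonormal columns spanning the column spaces of $\widetilde V_0,\widetilde W_0$, and for $\ell\ge1$ let $V_\ell,W_\ell$ have orthonormal columns spanning the column spaces of $[V_{\ell-1}\ \widetilde V_\ell]$, $[W_{\ell-1}\ \widetilde W_\ell]$. Then $\lambda_{\ell+1}$ is the eigenvalue (point of singularity) of $R_\ell(s)=P(s)+CV_\ell(sW_\ell^*V_\ell-W_\ell^*AV_\ell)^{-1}W_\ell^*B$ closest to $\tau$. $\eta_1(s)\ge\dots\ge\eta_{\mathsf n}(s)$ denote the eigenvalues of $R(s)^*R(s)$ (squared singular values of $R(s)$). $\nabla^2\eta(s)$ denotes the $2\times2$ Hessian with respect to $(\mathrm{Re}(s),\mathrm{Im}(s))$; $\sigma_{\min}$ is the smallest singular value. *)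

(* Defs.v *)
From HB Require Import structures.
From mathcomp Require Import all_boot all_order all_algebra.
From mathcomp Require Import all_classical all_reals.
From mathcomp Require Import topology normedtype derive.
From mathcomp Require Import complex.
Set Implicit Arguments. Unset Strict Implicit. Unset Printing Implicit Defensive.
Import Order.TTheory GRing.Theory Num.Theory.
Import numFieldNormedType.Exports.
Local Open Scope ring_scope.

Section Defs.
Variable R : realType.
Local Notation C := (R[i]).

Definition cabs (z : C) : R :=
  Num.sqrt (complex.Re z ^+ 2 + complex.Im z ^+ 2).

Definition ctr (m n : nat) (X : 'M[C]_(m, n)) : 'M[C]_(n, m) :=
  (map_mx (@conjc R) X)^T.

Definition eigs (n : nat) (M : 'M[C]_n) : seq C :=
  sort (fun x y : C => complex.Re y <= complex.Re x)
       (sval (closed_field_poly_normal (char_poly M))).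

(* eta_j (M) for j = 1..n : the j-th largest eigenvalue of the Hermitian
   matrix M (real-valued);  eta j with 1-based index j. *)
Definition eta (n : nat) (M : 'M[C]_n) (j : nat) : R := complex.Re (nth 0 (eigs M) j.-1).

Definition eta_of (n : nat) (X : C -> 'M[C]_n) (j : nat) (s : C) : R :=
  eta (ctr (X s) *m X s) j.

Definition sigma_min (n : nat) (X : 'M[C]_n) : R :=
  Num.sqrt (eta (ctr X *m X) n).

Definition as_R2 (f : C -> R) : R * R -> R := fun p => f (p.1 +i* p.2)%C.

Definition unit2 (i : 'I_2) : R * R := if i == ord0 then (1, 0) else (0, 1).
Definition hessian (f : C -> R) (s : C) : 'M[R]_2 :=
  \matrix_(i < 2, j < 2) ('D_(unit2 i) ('D_(unit2 j) (as_R2 f)) (complex.Re s, complex.Im s)).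

Definition matpoly (n d : nat) (Pc : 'I_d.+1 -> 'M[C]_n) (s : C) : 'M[C]_n :=
  \sum_(j < d.+1) s ^+ j *: Pc j.

Definition tf (n k d : nat) (Pc : 'I_d.+1 -> 'M[C]_n) (A : 'M[C]_k)
  (B : 'M[C]_(k, n)) (Cm : 'M[C]_(n, k)) (s : C) : 'M[C]_n :=
  matpoly Pc s + Cm *m invmx (s%:M - A) *m B.

Definition rtf (n k d r : nat) (Pc : 'I_d.+1 -> 'M[C]_n) (A : 'M[C]_k)
  (B : 'M[C]_(k, n)) (Cm : 'M[C]_(n, k)) (V W : 'M[C]_(k, r)) (s : C)
  : 'M[C]_n :=
  matpoly Pc s
  + Cm *m V *m invmx (s *: (ctr W *m V) - ctr W *m A *m V) *m ctr W *m B.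

Definition rtf_eigenvalue (n k d r : nat) (Pc : 'I_d.+1 -> 'M[C]_n)
  (A : 'M[C]_k) (B : 'M[C]_(k, n)) (Cm : 'M[C]_(n, k)) (V W : 'M[C]_(k, r))
  (s : C) : Prop :=
  (s *: (ctr W *m V) - ctr W *m A *m V) \in unitmx /\
  \det (rtf Pc A B Cm V W s) = 0.

Definition orthonormal_cols (k r : nat) (V : 'M[C]_(k, r)) : Prop :=
  ctr V *m V = 1%:M.

Definition colsub (k m r : nat) (X : 'M[C]_(k, m)) (V : 'M[C]_(k, r)) : Prop :=
  (X^T <= V^T)%MS.

(* the subspaces spanned by V and W contain the Hermite interpolation blocks
   tilde V = [(A - lam I)^{-1} B, ..., (A - lam I)^{-q} B] and
   tilde W = [(A - lam I)^{-*} C^*, ..., (A - lam I)^{-q*} C^*] *)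
Definition interp_subspaces (n k r q : nat) (A : 'M[C]_k) (B : 'M[C]_(k, n))
  (Cm : 'M[C]_(n, k)) (V W : 'M[C]_(k, r)) (lam : C) : Prop :=
  forall j : nat, (1 <= j <= q)%N ->
    colsub (invmx (A - lam%:M) ^+ j *m B) V /\
    colsub (invmx (ctr (A - lam%:M)) ^+ j *m ctr Cm) W.

End Defs.

(* Main.v *)
(** Let [G(s) = C (sI - A)^{-1} B], let [G_l] be its reduced version, and put
    [K_s = sI - A], [D_s = W^H K_s V] ([W^H] the conjugate transpose).  The interpolation conditions at [lam]
    give [G(s) - G_l(s) =
    (s - lam)^2 C K_lam^{-1} (K_s^{-1} - V D_s^{-1} W^H) K_lam^{-1} B],
    which is [O(|s - lam|^2)] uniformly in [V] and [W].  A kernel vector of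
    [R_l(lam')] therefore shows [det R(lam') = O(|lam' - lam|^2)].  If
    [lamstar] is a simple zero of [det R], then
    [|lam' - lamstar| = O(|lam' - lam|^2)], and the quadratic estimate follows
    since the part of the right-hand side quadratic in [lam' - lamstar] can be
    absorbed.  If [lamstar] is a multiple zero, a nonvanishing column of the
    adjugate shows that the smallest singular value [sigma] of [R(s)] is
    [O(|s - lamstar|^2)]; [sigma] being Lipschitz, the gradient of
    [eta_n = sigma^2] is [O(sigma)], so the Hessian of [eta_n] vanishes at
    [lamstar]. *)
Require Import Defs.
From HB Require Import structures.
From mathcomp Require Import all_boot all_order all_algebra.
From mathcomp Require Import all_classical all_reals.
From mathcomp Require Import topology normedtype derive.
From mathcomp Require Import complex.
From mathcomp Require Import ring lra spectral.
Import Order.TTheory GRing.Theory Num.Theory.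
Import numFieldNormedType.Exports.
Local Open Scope ring_scope.
Set Implicit Arguments. Unset Strict Implicit. Unset Printing Implicit Defensive.

(** * Complex modulus and the entrywise l1 norm of matrices *)

Section Modulus.
Variable R : realType.
Implicit Types x y z : R[i].

Lemma cabsE z : (cabs z)%:C%C = `|z|.
Proof. by rewrite normc_def. Qed.

Lemma cabs_ge0 z : 0 <= cabs z.
Proof. exact: sqrtr_ge0. Qed.

Lemma cabs0 : cabs (0 : R[i]) = 0.
Proof. by apply: complexI; rewrite cabsE normr0. Qed.

Lemma cabs1 : cabs (1 : R[i]) = 1.
Proof. by apply: complexI; rewrite cabsE normr1. Qed.

Lemma cabs_gt0 z : (0 < cabs z) = (z != 0).
Proof. by rewrite -ltcR cabsE normr_gt0. Qed.

Lemma cabs_eq0 z : (cabs z == 0) = (z == 0).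
Proof. by rewrite -[RHS]normr_eq0 -cabsE (inj_eq (@complexI R)). Qed.

Lemma cabsM x y : cabs (x * y) = cabs x * cabs y.
Proof. by apply: complexI; rewrite rmorphM /= !cabsE normrM. Qed.

Lemma cabsX z n : cabs (z ^+ n) = cabs z ^+ n.
Proof. by elim: n => [|n IH]; rewrite ?expr0 ?cabs1 // !exprS cabsM IH. Qed.

Lemma cabsV z : cabs z^-1 = (cabs z)^-1.
Proof. by apply: complexI; rewrite fmorphV /= !cabsE normfV. Qed.

Lemma cabsN z : cabs (- z) = cabs z.
Proof. by apply: complexI; rewrite !cabsE normrN. Qed.

Lemma cabsC x y : cabs (x - y) = cabs (y - x).
Proof. by rewrite -cabsN opprB. Qed.

Lemma cabsJ z : cabs (conjc z) = cabs z.
Proof. by apply: complexI; rewrite !cabsE normcJ. Qed.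

Lemma ler_cabsD x y : cabs (x + y) <= cabs x + cabs y.
Proof. by rewrite -lecR rmorphD /= !cabsE ler_normD. Qed.

Lemma ler_cabs_sum (I : Type) (r : seq I) (P : pred I) (F : I -> R[i]) :
  cabs (\sum_(i <- r | P i) F i) <= \sum_(i <- r | P i) cabs (F i).
Proof.
elim/big_rec2: _ => [|i a b _ ab]; first by rewrite cabs0.
by apply: (le_trans (ler_cabsD _ _)); rewrite lerD2l.
Qed.

Lemma cabs_sqr z : (cabs z ^+ 2)%:C%C = z * conjc z.
Proof. by rewrite rmorphXn /= cabsE sqr_normc. Qed.

End Modulus.

Section EntrySum.
Variable R : realType.

Definition mxsum1 (m n : nat) (X : 'M[R[i]]_(m, n)) : R :=
  \sum_i \sum_j cabs (X i j).

Lemma mxsum1_ge0 m n (X : 'M[R[i]]_(m, n)) : 0 <= mxsum1 X.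
Proof. by do 2 apply: sumr_ge0 => ? _; apply: cabs_ge0. Qed.

Lemma mxsum1_eq0 m n (X : 'M[R[i]]_(m, n)) : mxsum1 X = 0 -> X = 0.
Proof.
move=> X0; apply/matrixP => i j; rewrite mxE; apply/eqP; rewrite -cabs_eq0.
move/eqP: X0; rewrite psumr_eq0; last first.
  by move=> ? _; apply: sumr_ge0 => ? _; apply: cabs_ge0.
move/allP/(_ i (mem_index_enum _)); rewrite /= psumr_eq0; last first.
  by move=> ? _; apply: cabs_ge0.
by move/allP/(_ j (mem_index_enum _)).
Qed.

Lemma mxsum1_le m n (X : 'M[R[i]]_(m, n)) (a : R) :
  (forall i j, cabs (X i j) <= a) -> mxsum1 X <= (m * n)%:R * a.
Proof.
move=> H; apply: (@le_trans _ _ (\sum_(i < m) \sum_(j < n) a)).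
  by do 2 apply: ler_sum => ? _.
by rewrite !sumr_const !card_ord -mulrnA mulr_natl mulnC.
Qed.

Lemma mxsum1D m n (X Y : 'M[R[i]]_(m, n)) : mxsum1 (X + Y) <= mxsum1 X + mxsum1 Y.
Proof.
rewrite /mxsum1 -big_split /=; apply: ler_sum => i _.
by rewrite -big_split /=; apply: ler_sum => j _; rewrite mxE ler_cabsD.
Qed.

Lemma mxsum1Z m n a (X : 'M[R[i]]_(m, n)) : mxsum1 (a *: X) = cabs a * mxsum1 X.
Proof.
rewrite /mxsum1 big_distrr /=; apply: eq_bigr => i _; rewrite big_distrr /=.
by apply: eq_bigr => j _; rewrite mxE cabsM.
Qed.

Lemma mxsum1N m n (X : 'M[R[i]]_(m, n)) : mxsum1 (- X) = mxsum1 X.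
Proof. by do 2 (apply: eq_bigr => ? _); rewrite mxE cabsN. Qed.

Lemma mxsum1B m n (X Y : 'M[R[i]]_(m, n)) : mxsum1 (X - Y) <= mxsum1 X + mxsum1 Y.
Proof. by rewrite -(mxsum1N Y) mxsum1D. Qed.

Lemma mxsum1M m n p (X : 'M[R[i]]_(m, n)) (Y : 'M[R[i]]_(n, p)) :
  mxsum1 (X *m Y) <= mxsum1 X * mxsum1 Y.
Proof.
rewrite /mxsum1 mulr_suml; apply: ler_sum => i _.
apply: (@le_trans _ _ (\sum_(l < n) cabs (X i l) * \sum_j cabs (Y l j))).
  under [leRHS]eq_bigr do rewrite mulr_sumr.
  rewrite exchange_big /=; apply: ler_sum => j _; rewrite mxE.
  by apply: le_trans (ler_cabs_sum _ _ _) _; apply: ler_sum => l _; rewrite cabsM.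
rewrite mulr_suml; apply: ler_sum => l _; apply: ler_wpM2l; first exact: cabs_ge0.
rewrite (bigD1 l) //= lerDl.
by do 2 apply: sumr_ge0 => ? _; apply: cabs_ge0.
Qed.

Lemma mxsum1_ctr m n (X : 'M[R[i]]_(m, n)) : mxsum1 (ctr X) = mxsum1 X.
Proof.
rewrite /mxsum1 exchange_big; apply: eq_bigr => i _; apply: eq_bigr => j _.
by rewrite !mxE cabsJ.
Qed.

End EntrySum.

(** * Spectra of Gram matrices and the variational description of the smallest eigenvalue *)

Section GramSpectrum.
Variable R : realType.

Lemma ctrM m n p (X : 'M[R[i]]_(m, n)) (Y : 'M[R[i]]_(n, p)) :
  ctr (X *m Y) = ctr Y *m ctr X.
Proof. by rewrite /ctr map_mxM trmx_mul. Qed.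

Lemma ctrK m n (X : 'M[R[i]]_(m, n)) : ctr (ctr X) = X.
Proof. by apply/matrixP => i j; rewrite !mxE conjcK. Qed.

Definition l2sq n (v : 'cV[R[i]]_n) : R := \sum_i cabs (v i 0) ^+ 2.

Lemma l2sq_ge0 n (v : 'cV[R[i]]_n) : 0 <= l2sq v.
Proof. by apply: sumr_ge0 => i _; rewrite sqr_ge0. Qed.

Lemma l2sq_eq0 n (v : 'cV[R[i]]_n) : l2sq v = 0 -> v = 0.
Proof.
move/eqP; rewrite psumr_eq0 => [/allP H|i _]; last by rewrite sqr_ge0.
apply/matrixP => i j; rewrite ord1 mxE; apply/eqP.
by have := H i (mem_index_enum _); rewrite /= sqrf_eq0 cabs_eq0.
Qed.

Lemma cabs2_le_l2sq n (v : 'cV[R[i]]_n) i : cabs (v i 0) ^+ 2 <= l2sq v.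
Proof.
by rewrite /l2sq (bigD1 i) //= lerDl; apply: sumr_ge0 => j _; rewrite sqr_ge0.
Qed.

Lemma l2sqZ n a (v : 'cV[R[i]]_n) : l2sq (a *: v) = cabs a ^+ 2 * l2sq v.
Proof.
by rewrite /l2sq mulr_sumr; apply: eq_bigr => i _; rewrite mxE cabsM exprMn.
Qed.

Lemma l2sq_ctr n (v : 'cV[R[i]]_n) : (l2sq v)%:C%C = (ctr v *m v) 0 0.
Proof.
rewrite /l2sq rmorph_sum mxE; apply: eq_bigr => i _.
by rewrite !mxE mulrC -cabs_sqr.
Qed.

(** [eigs] is a sorted list of roots of the characteristic polynomial. The spectral theorem, applied
    to the Hermitian matrix [ctr M *m M], ties these roots to an orthonormal eigenbasis. *)
Lemma gram_spectral n (M : 'M[R[i]]_n) :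
  exists (P : 'M[R[i]]_n) (s : 'I_n -> R),
  [/\ ctr P *m P = 1%:M, P *m ctr P = 1%:M,
      ctr M *m M = ctr P *m diag_mx (\row_i (s i)%:C%C) *m P &
      perm_eq (eigs (ctr M *m M)) [seq (s i)%:C%C | i <- enum 'I_n]].
Proof.
set H := ctr M *m M.
pose P := spectralmx H; pose sp := spectral_diag H.
have HH : H \is hermsymmx.
  apply/is_hermitianmxP; rewrite expr0 scale1r.
  rewrite -[LHS]ctrK {1}/H ctrM ctrK.
  by apply/matrixP => i j; rewrite !mxE.
have PP : P *m ctr P = 1%:M.
  rewrite /ctr map_trmx; exact: (elimT unitarymxP (spectral_unitarymx H)).
have PP' : ctr P *m P = 1%:M by apply: mulmx1C.
have HE : H = ctr P *m diag_mx sp *m P.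
  have /orthomx_spectralP := hermitian_normalmx HH.
  rewrite -/P -/sp => {1}->; congr (_ *m _ *m _).
  by rewrite -[RHS]mulmx1 -(mulmxV (spectral_unit H)) mulmxA PP' mul1mx.
(* Each eigenvalue is the squared length of the image of its unit eigenvector, hence real. *)
have spR i : sp 0 i = (l2sq (M *m (ctr P *m delta_mx i 0)))%:C%C.
  rewrite l2sq_ctr ctrM -mulmxA (mulmxA (ctr M)) -/H HE ctrM ctrK.
  rewrite !mulmxA -(mulmxA _ P (ctr P)) PP mulmx1.
  rewrite -(mulmxA _ P (ctr P)) PP mulmx1.
  have -> : ctr (delta_mx i 0 : 'cV[R[i]]_n) = delta_mx 0 i.
    by rewrite /ctr map_delta_mx trmx_delta.
  by rewrite -rowE row_diag_mx -scalemxAl mul_delta_mx !mxE !eqxx mulr1.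
exists P, (fun i => l2sq (M *m (ctr P *m delta_mx i 0))).
have spE : \row_i (l2sq (M *m (ctr P *m delta_mx i 0)))%:C%C = sp.
  by apply/rowP => i; rewrite mxE spR.
split => //; first by rewrite spE.
rewrite /eigs perm_sort.
case: closed_field_poly_normal => r /=.
have -> : char_poly H = \prod_(z <- [seq sp 0 i | i <- enum 'I_n]) ('X - z%:P).
  transitivity (char_poly (diag_mx sp)).
    rewrite HE {1}/char_poly {1}/char_poly_mx !map_mxM /=.
    (* Writing ['X%:M] as its own unitary conjugate lets both factors of [P] leave the
       determinant. *)
    have -> : ('X%:M : 'M[{poly R[i]}]_n) = map_mx polyC (ctr P) *m 'X%:M *m map_mx polyC P.
      by rewrite scalar_mxC -mulmxA -map_mxM PP' map_mx1 mulmx1.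
    rewrite -mulmxBl -mulmxBr !det_mulmx mulrAC -det_mulmx -map_mxM PP'.
    by rewrite map_mx1 det1 mul1r.
  rewrite (char_poly_trig (diag_mx_is_trig _)) big_map big_enum /=.
  by apply: eq_bigr => i _; rewrite mxE eqxx.
rewrite (monicP (monic_prod_XsubC _ _ _)) scale1r => /prod_XsubC_eq; rewrite perm_sym.
by rewrite -(eq_map (f := fun i => sp 0 i)).
Qed.

(** The list is sorted by decreasing real part, so its last entry, at index [n.-1], is the least. *)
Lemma eta_bottom n (M : 'M[R[i]]_n) (s : 'I_n -> R) :
  perm_eq (eigs M) [seq (s i)%:C%C | i <- enum 'I_n] ->
  (forall i, Defs.eta M n <= s i) /\ ((0 < n)%N -> exists i, s i = Defs.eta M n).
Proof.
move=> E; have sz : size (eigs M) = n.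
  by rewrite (perm_size E) size_map size_enum_ord.
have so : sorted (fun x y : R[i] => complex.Re y <= complex.Re x) (eigs M).
  by apply: sort_sorted => x y; rewrite orbC; exact: le_total.
split=> [i|n0].
  have : (s i)%:C%C \in eigs M by rewrite (perm_mem E); apply/mapP; exists i; rewrite ?mem_enum.
  move=> /(nthP 0) [j]; rewrite sz => jn jE.
  have -> : s i = complex.Re (nth 0 (eigs M) j) by rewrite jE.
  rewrite /Defs.eta; apply: (sorted_leq_nth
    (leT := fun x y : R[i] => complex.Re y <= complex.Re x)) => //.
  - by move=> x y z /= yx xz; apply: le_trans xz yx.
  - by rewrite inE sz.
  - by rewrite inE sz; case: (n) jn.
  - by case: (n) jn.
have : nth 0 (eigs M) n.-1 \in eigs M by rewrite mem_nth // sz prednK.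
rewrite (perm_mem E) => /mapP[i _ iE]; exists i.
by rewrite /Defs.eta iE.
Qed.

Lemma l2sq_unitary n (P : 'M[R[i]]_n) (v : 'cV[R[i]]_n) :
  ctr P *m P = 1%:M -> l2sq (P *m v) = l2sq v.
Proof.
move=> PP; apply: complexI.
by rewrite !l2sq_ctr ctrM -mulmxA (mulmxA (ctr P)) PP mul1mx.
Qed.

Lemma l2sq_spectral n (M P : 'M[R[i]]_n) (s : 'I_n -> R) (v : 'cV[R[i]]_n) :
  ctr M *m M = ctr P *m diag_mx (\row_i (s i)%:C%C) *m P ->
  l2sq (M *m v) = \sum_i s i * cabs ((P *m v) i 0) ^+ 2.
Proof.
move=> E; apply: complexI; rewrite l2sq_ctr ctrM -mulmxA (mulmxA (ctr M)) E.
rewrite -!mulmxA mulmxA -ctrM mxE rmorph_sum; apply: eq_bigr => i _.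
rewrite mul_diag_mx !mxE /= rmorphM /= cabs_sqr.
by rewrite [LHS]mulrC -mulrA.
Qed.

(** In the eigenbasis [l2sq (M *m v)] is a sum with weights [s i], all at least [eta]. This is the
    Rayleigh bound; [eta_attained] shows that an eigenvector reaches it. *)
Lemma eta_le_l2sq n (M : 'M[R[i]]_n) (v : 'cV[R[i]]_n) :
  Defs.eta (ctr M *m M) n * l2sq v <= l2sq (M *m v).
Proof.
have [P [s [PP _ ME /eta_bottom[le_s _]]]] := gram_spectral M.
rewrite (l2sq_spectral v ME) -(l2sq_unitary v PP) mulr_sumr.
by apply: ler_sum => i _; rewrite ler_wpM2r ?sqr_ge0.
Qed.

Lemma eta_attained n (M : 'M[R[i]]_n) : (0 < n)%N ->
  exists2 v : 'cV[R[i]]_n, l2sq v = 1 & l2sq (M *m v) = Defs.eta (ctr M *m M) n.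
Proof.
move=> n0; have [P [s [PP PP' ME /eta_bottom[_ /(_ n0) [i0 <-]]]]] := gram_spectral M.
have pE i : cabs ((delta_mx i0 0 : 'cV[R[i]]_n) i 0) ^+ 2 = (i == i0)%:R.
  by rewrite mxE eqxx andbT; case: eqP; rewrite ?cabs1 ?cabs0 ?expr1n ?expr0n.
exists (ctr P *m delta_mx i0 0).
  rewrite -(l2sq_unitary _ PP) mulmxA PP' mul1mx /l2sq.
  by under eq_bigr do rewrite pE; rewrite (bigD1 i0) //= eqxx big1 ?addr0 // => i /negbTE ->.
rewrite (l2sq_spectral _ ME) mulmxA PP' mul1mx.
under eq_bigr do rewrite pE.
by rewrite (bigD1 i0) //= eqxx mulr1 big1 ?addr0 // => i /negbTE ->; rewrite mulr0.
Qed.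

(** At most one eigenvalue of the Gram matrix fails to be positive, so a rank-one change of its
    diagonal form is invertible. *)
Lemma rank_ge_pred n (M : 'M[R[i]]_n) :
  (forall j, (1 <= j < n)%N -> 0 < Defs.eta (ctr M *m M) j) -> (n.-1 <= \rank M)%N.
Proof.
case: n M => [//|n] M H /=.
have [P [s [PP PP' ME E]]] := gram_spectral M.
have sz : size (eigs (ctr M *m M)) = n.+1.
  by rewrite (perm_size E) size_map size_enum_ord.
(* [eta j] reads entry [j.-1] of the sorted list, so the hypothesis covers every entry except the
   last. *)
have cnt : (count (fun x : R[i] => (complex.Re x <= 0)%R) (eigs (ctr M *m M)) <= 1)%N.
  case/lastP E1 : (eigs _) sz => [//|t x]; rewrite size_rcons => -[szt].
  rewrite -cats1 count_cat /= addn0.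
  rewrite [X in (X + _)%N](_ : _ = 0%N); first by case: (_ <= _).
  apply/eqP; rewrite -leqn0 leqNgt -has_count; apply/hasPn => y /(nthP 0)[j jt <-].
  have := H j.+1; rewrite szt in jt; move/(_ jt).
  by rewrite /Defs.eta E1 /= nth_rcons szt jt ltNge.
have [i0 Hi0] : exists i0, forall i, i != i0 -> 0 < s i.
  case: (pickP (fun i => s i <= 0)) => [i0 si0|H0]; last first.
    by exists ord0 => i _; have := H0 i; rewrite ltNge => ->.
  exists i0 => i ii0; rewrite ltNge; apply/negP => si.
  move: cnt; rewrite (permP E) count_map -size_filter.
  set f := seq.filter _ _ => szf.
  have : (size [:: i; i0] <= size f)%N.
    apply: uniq_leq_size; first by rewrite /= inE ii0.
    by move=> x; rewrite !inE mem_filter mem_enum andbT /= => /orP[] /eqP ->.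
  by move=> /leq_trans /(_ szf).
have s0 : 0 <= s i0.
  have := l2sq_ge0 (M *m (ctr P *m delta_mx i0 0)).
  rewrite (l2sq_spectral _ ME) mulmxA PP' mul1mx (bigD1 i0) //= !mxE !eqxx cabs1 expr1n mulr1.
  by rewrite big1 ?addr0 // => i /negbTE ii0; rewrite mxE ii0 cabs0 expr0n mulr0.
pose D := diag_mx (\row_i (s i)%:C%C).
have rD : (\rank D <= \rank M)%N.
  apply: leq_trans (mxrankM_maxr (ctr M) M).
  rewrite ME mxrankMfree; last by rewrite row_free_unit; case: (mulmx1_unit PP).
  by rewrite eqmxMfull // row_full_unit; case: (mulmx1_unit PP).
apply: leq_trans rD.
(* Raising the entry at [i0] by one makes the whole diagonal positive and raises the rank by at most
   one. *)
have : (\rank (D + delta_mx i0 i0)%R <= \rank D + 1)%N.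
  by apply: leq_trans (mxrank_add _ _) _; rewrite mxrank_delta.
rewrite mxrank_unit ?addn1 ?ltnS //.
have -> : D + delta_mx i0 i0 = diag_mx (\row_i (s i + (i == i0)%:R)%:C%C).
  apply/matrixP => i j; rewrite !mxE; case: (altP (i =P j)) => [<-|ij].
    by rewrite !mulr1n rmorphD andbb /=; case: (_ == _).
  rewrite !mulr0n add0r; case: eqP => //= ii; case: eqP => //= ji.
  by rewrite ii ji eqxx in ij.
rewrite unitmxE unitfE det_diag; apply/prodf_neq0 => i _; rewrite mxE.
rewrite fmorph_eq0; apply/lt0r_neq0; case: eqP => [->|/eqP /Hi0]; last by rewrite addr0.
by rewrite ltr_wpDl.
Qed.

End GramSpectrum.

(** * A criterion for a vanishing Hessian *)

(* No differentiability is assumed: where the limit does not exist, ['D_v f a]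
   is [0]. *)
Lemma norm_derive_le (R : realType) (V : normedModType R) (f : V -> R)
    (a v : V) (K L e : R) :
  0 < e -> 0 <= K -> 0 <= L ->
  (forall h, `|h| < e -> `|f (h *: v + a) - f a| <= `|h| * (K + L * `|h|)) ->
  `|'D_v f a| <= K.
Proof.
move=> e0 K0 L0 H; rewrite /derive.
set q := (X in lim X).
have [cq|ncq] := pselect (cvg q); last first.
  by rewrite dvgP // normr0.
apply/ler_addgt0Pr => eps eps0.
have e2 : 0 < eps / 2 by rewrite divr_gt0.
have d0 : 0 < eps / 2 / (L + 1) by rewrite divr_gt0 // ltr_wpDl.
have /cvgrPdist_le /(_ _ e2) H1 := cq.
(* Below this radius the term [L * |h|] is at most [eps / 2]; the other half of [eps] pays for the
   distance from the quotient to its limit. *)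
pose d := Num.min e (eps / 2 / (L + 1)).
have dd : 0 < d by rewrite lt_min e0.
have [h [h1 h2 h3]] : exists h : R,
    [/\ `|lim q - h^-1 *: ((f \o shift a) (h *: v) - f a)| <= eps / 2,
        h != 0 & `|h| < d].
  apply: (@filter_ex _ (dnbhs (0 : R)) _); near=> h; split; near: h.
  - exact: H1.
  - exact: nbhs_dnbhs_neq.
  - exact: dnbhs0_lt.
move: h3; rewrite lt_min => /andP[he hd].
have := H _ he; rewrite -ler_pdivrMl ?normr_gt0 // -normfV -normrM => H3.
rewrite -[lim q](subrK (h^-1 *: ((f \o shift a) (h *: v) - f a))).
apply: (le_trans (ler_normD _ _)).
have : L * `|h| <= eps / 2.
  rewrite ltr_pdivlMr ?ltr_wpDl // in hd.
  apply: le_trans (ltW hd); rewrite mulrC ler_wpM2l //; lra.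
move: h1 H3; rewrite /GRing.scale /= /shift /=.
by lra.
Unshelve. all: by end_near.
Qed.

(** Letting [z] tend to [y] bounds the first partials at [y] by [K * cabs (y - s) ^+ 2]. They vanish
    at [s] and are of second order around it, so their own derivatives at [s] are zero. *)
Lemma hessian_eq0 (R : realType) (f : R[i] -> R) (s : R[i]) (K e : R) :
  0 < e -> 0 <= K ->
  (forall y z, cabs (y - s) < e -> cabs (z - y) < e ->
     `|f z - f y| <= K * cabs (z - y) * (cabs (y - s) ^+ 2 + cabs (z - y))) ->
  hessian f s = 0.
Proof.
move=> e0 K0 H.
have cabsr (h : R) i : cabs ((h *: unit2 R i).1 +i* (h *: unit2 R i).2)%C = `|h|.
  rewrite /cabs /unit2; case: ifP => _ /=;
  by rewrite scaler0 scaler1 expr0n /= ?addr0 ?add0r sqrtr_sqr.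
have D1 (p : R * R) j : cabs ((p.1 +i* p.2)%C - s) < e ->
    `|'D_(unit2 R j) (as_R2 f) p| <= K * cabs ((p.1 +i* p.2)%C - s) ^+ 2.
  move=> ps; apply: (@norm_derive_le _ _ _ _ _ _ K e) => //.
    by rewrite mulr_ge0 // sqr_ge0.
  move=> h he; rewrite /as_R2.
  have E : cabs (((h *: unit2 R j + p).1 +i* (h *: unit2 R j + p).2)%C - (p.1 +i* p.2)%C) = `|h|.
    rewrite -[RHS](cabsr h j); congr cabs.
    by case: (h *: unit2 R j) => a b; case: p {ps} => c d; simpc; rewrite /= !addrK.
  have := H _ _ ps; move/(_ ((h *: unit2 R j + p).1 +i* (h *: unit2 R j + p).2)%C).
  rewrite E => /(_ he) /le_trans; apply.
  by rewrite le_eqVlt; apply/orP; left; apply/eqP; ring.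
apply/matrixP => i j; rewrite !mxE; apply/eqP; rewrite -normr_le0.
have sE : (complex.Re s +i* complex.Im s)%C = s by case: s {H D1}.
have z0 : cabs (s - s) = 0 by rewrite subrr /cabs /= expr0n /= addr0 sqrtr0.
(* The linear constant is now [0], and [K] is the quadratic one. *)
apply: (@norm_derive_le _ _ _ _ _ _ K (Num.min e 1)) => //.
  by rewrite lt_min e0 ltr01.
move=> h; rewrite lt_min => /andP[he h1].
have -> : 'D_(unit2 R j) (as_R2 f) (complex.Re s, complex.Im s) = 0.
  apply/eqP; rewrite -normr_le0; have := D1 (complex.Re s, complex.Im s) j.
  by rewrite /= sE z0 expr0n /= mulr0; apply.
rewrite subr0.
have E : cabs (((h *: unit2 R i + (complex.Re s, complex.Im s)).1 +i*
    (h *: unit2 R i + (complex.Re s, complex.Im s)).2)%C - s) = `|h|.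
  rewrite -[RHS](cabsr h i); congr cabs.
  by case: (h *: unit2 R i) => a b; case: s {H D1 sE z0}=> c d; simpc; rewrite /= !addrK.
have := D1 (h *: unit2 R i + (complex.Re s, complex.Im s)) j; rewrite E => /(_ he).
move/le_trans; apply; rewrite add0r; rewrite le_eqVlt; apply/orP; left; apply/eqP; ring.
Qed.

(** * Adjugates and matrices of polynomials *)

Section Adjugate.

(** Both sides give the same scalar matrix when multiplied by [A *m B], and the nonzero determinant
    can be cancelled. *)
Lemma adj_mulmx_idomain (D : idomainType) n (A B : 'M[D]_n) :
  \det A != 0 -> \det B != 0 -> \adj (A *m B) = \adj B *m \adj A.
Proof.
move=> dA dB; have dAB : \det (A *m B) != 0 by rewrite det_mulmx mulf_neq0.
have E : \adj (A *m B) *m (A *m B) = \adj B *m \adj A *m (A *m B).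
  rewrite mul_adj_mx det_mulmx mulmxA -(mulmxA (\adj B)) mul_adj_mx.
  by rewrite mul_mx_scalar -scalemxAl mul_adj_mx scale_scalar_mx.
have : \det (A *m B) *: (\adj (A *m B)) = \det (A *m B) *: (\adj B *m \adj A).
  have Z (X : 'M[D]_n) : \det (A *m B) *: X = X *m (A *m B) *m \adj (A *m B).
    by rewrite -mulmxA mul_mx_adj mul_mx_scalar.
  by rewrite !Z E.
move=> /matrixP H; apply/matrixP => i j; apply: (mulfI dAB).
by have := H i j; rewrite !mxE.
Qed.

(* Over a field, shifting both factors by the indeterminate makes their
   determinants nonzero; the identity is then evaluated at 0. *)
Lemma adj_mulmx (F : fieldType) n (A B : 'M[F]_n) :
  \adj (A *m B) = \adj B *m \adj A.
Proof.
pose S (M : 'M[F]_n) := char_poly_mx (- M).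
have S0 M : map_mx (horner_eval 0) (S M) = M.
  apply/matrixP => i j; rewrite !mxE /horner_eval.
  by rewrite !hornerE hornerMn hornerX mul0rn sub0r opprK.
have dS M : \det (S M) != 0 by apply: monic_neq0; apply: char_poly_monic.
have := congr1 (map_mx (horner_eval 0)) (adj_mulmx_idomain (dS A) (dS B)).
by rewrite map_mxM !map_mx_adj map_mxM !S0.
Qed.

(** Since the adjugate reverses products and preserves units, the rank factorization of [A] reduces
    the claim to [pid_mx (\rank A)], which has a cofactor equal to one. *)
Lemma adj_neq0 (F : fieldType) n (A : 'M[F]_n) :
  (0 < n)%N -> (n.-1 <= \rank A)%N -> \adj A != 0.
Proof.
case: n A => [//|n] A _ /= rA; apply/eqP => A0.
have unitadj (M : 'M[F]_n.+1) : M \in unitmx -> \adj M \in unitmx.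
  move=> Mu; have := mul_adj_mx M; move/(congr1 (mulmxr (((\det M)^-1)%:M))) => /=.
  rewrite -scalar_mxM mulfV -?unitfE // -mulmxA => H.
  by case: (mulmx1_unit H).
have : \adj (pid_mx (\rank A) : 'M[F]_n.+1) = 0.
  move: A0; rewrite -{1}(mulmx_ebase A) !adj_mulmx.
  set U := \adj (row_ebase A); set T := \adj _; set L := \adj _ => H.
  have Uu : U \in unitmx by apply/unitadj/row_ebase_unit.
  have Lu : L \in unitmx by apply/unitadj/col_ebase_unit.
  have -> : T = invmx U *m (U *m (T *m L)) *m invmx L by rewrite mulKmx ?mulmxK.
  by rewrite H mulmx0 mul0mx.
move/matrixP/(_ ord_max ord_max)/eqP; rewrite !mxE /cofactor.
(* Deleting the last row and column of [pid_mx (\rank A)] leaves the identity, because the rank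
   falls short by at most one. *)
rewrite (_ : row' _ _ = 1%:M) ?det1 ?mulr1 ?signr_eq0 //.
apply/matrixP => i j; rewrite !mxE !lift_max.
by rewrite (leq_trans (ltn_ord i) rA) andbT.
Qed.

End Adjugate.

Lemma det0_cVP (F : fieldType) n (A : 'M[F]_n) :
  \det A = 0 -> exists2 v : 'cV[F]_n, v != 0 & A *m v = 0.
Proof.
rewrite -det_tr => /eqP /det0P [v v0 vA]; exists v^T.
  by apply: contra_neq v0 => vE; rewrite -[v]trmxK vE trmx0.
by rewrite -[A]trmxK -trmx_mul vA trmx0.
Qed.

(** * Local bounds for polynomials and for matrices of polynomials *)

Section PolynomialBounds.
Variable R : realType.
Implicit Types (p : {poly R[i]}) (c : R[i]).

(** Induction along the Horner scheme; a single constant serves as sup bound and as Lipschitz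
    constant on the unit disc about [c]. *)
Lemma horner_lipschitz p c : exists2 M : R, 0 <= M & forall x y,
  cabs (x - c) <= 1 -> cabs (y - c) <= 1 ->
  cabs p.[x] <= M /\ cabs (p.[x] - p.[y]) <= M * cabs (x - y).
Proof.
elim/poly_ind: p => [|p a [M M0 IH]].
  by exists 0 => // x y _ _; rewrite !horner0 subrr cabs0 mul0r.
pose T := 1 + cabs c.
have T0 : 1 <= T by rewrite lerDl cabs_ge0.
have le_T x : cabs (x - c) <= 1 -> cabs x <= T.
  by move=> xc; rewrite -[x](subrK c) (le_trans (ler_cabsD _ _)) // lerD2r.
exists (M * (T + 1) + cabs a) => [|x y xc yc].
  by rewrite addr_ge0 ?cabs_ge0 // mulr_ge0 // addr_ge0 // (le_trans ler01).
have [px pl] := IH x y xc yc; have [py _] := IH y x yc xc.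
have a0 := cabs_ge0 a; have xT := le_T x xc.
rewrite !hornerE; split.
  apply: (le_trans (ler_cabsD _ _)); rewrite lerD2r cabsM.
  apply: (@le_trans _ _ (M * T)); last by rewrite ler_wpM2l // lerDl.
  by apply: ler_pM; rewrite ?cabs_ge0.
have -> : p.[x] * x + a - (p.[y] * y + a) = (p.[x] - p.[y]) * x + p.[y] * (x - y) by ring.
apply: (le_trans (ler_cabsD _ _)); rewrite !cabsM.
apply: (@le_trans _ _ (M * cabs (x - y) * T + M * cabs (x - y))).
  by apply: lerD; [apply: ler_pM | apply: ler_wpM2r]; rewrite ?cabs_ge0.
have := mulr_ge0 a0 (cabs_ge0 (x - y)); lra.
Qed.

Lemma horner_neq0_near p c : p.[c] != 0 ->
  exists2 d : R, 0 < d <= 1 & exists2 m : R, 0 < m &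
  forall x, cabs (x - c) <= d -> m <= cabs p.[x].
Proof.
rewrite -cabs_gt0 => p0; have [M M0 H] := horner_lipschitz p c.
set m := cabs p.[c] in p0 *.
(* Within this radius [p] moves by at most half of its modulus [m] at [c]. *)
exists (Num.min 1 (m / 2 / (M + 1))).
  rewrite ge_min lexx /= lt_min ltr01 /= andbT.
  by rewrite !divr_gt0 // ltr_wpDl.
exists (m / 2); first by rewrite divr_gt0.
move=> x; rewrite le_min => /andP[x1 xm].
have c1 : cabs (c - c) <= 1 by rewrite subrr cabs0.
have [_ l] := H c x c1 x1.
have : m <= cabs (p.[c] - p.[x]) + cabs p.[x].
  by rewrite /m -{1}[p.[c]](subrK p.[x]) ler_cabsD.
move: xm; rewrite ler_pdivlMr ?ltr_wpDl // => xm.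
have := cabs_ge0 (x - c).
rewrite (cabsC c x) in l; lra.
Qed.

Definition mxev m n (N : 'M[{poly R[i]}]_(m, n)) (s : R[i]) : 'M[R[i]]_(m, n) :=
  map_mx (horner_eval s) N.

Lemma mxev_lipschitz m n (N : 'M[{poly R[i]}]_(m, n)) c :
  exists2 M : R, 0 <= M & forall x y,
  cabs (x - c) <= 1 -> cabs (y - c) <= 1 ->
  mxsum1 (mxev N x) <= M /\ mxsum1 (mxev N x - mxev N y) <= M * cabs (x - y).
Proof.
pose L i j := s2val (cid2 (horner_lipschitz (N i j) c)).
exists (\sum_i \sum_j L i j) => [|x y xc yc].
  by do 2 apply: sumr_ge0 => ? _; rewrite /L; case: cid2.
split.
  apply: ler_sum => i _; apply: ler_sum => j _; rewrite mxE /horner_eval.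
  by have [] := s2valP' (cid2 (horner_lipschitz (N i j) c)) x y xc yc.
rewrite mulr_suml; apply: ler_sum => i _; rewrite mulr_suml; apply: ler_sum => j _.
rewrite !mxE /horner_eval.
by have [] := s2valP' (cid2 (horner_lipschitz (N i j) c)) x y xc yc.
Qed.

Lemma mxev_adj n (N : 'M[{poly R[i]}]_n) s : mxev (\adj N) s = \adj (mxev N s).
Proof. exact: map_mx_adj. Qed.

Lemma det_mxev n (N : 'M[{poly R[i]}]_n) s : \det (mxev N s) = (\det N).[s].
Proof. exact: det_map_mx. Qed.

End PolynomialBounds.

(** * The smallest singular value near a multiple zero of the determinant *)

Section EtaPerturbation.
Variable R : realType.

Lemma gram_eta_ge0 n (M : 'M[R[i]]_n) : (0 < n)%N -> 0 <= Defs.eta (ctr M *m M) n.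
Proof. by move=> /(eta_attained M)[v _ <-]; apply: l2sq_ge0. Qed.

Lemma cabs_le_sqrt_l2sq n (v : 'cV[R[i]]_n) i : cabs (v i 0) <= Num.sqrt (l2sq v).
Proof.
by rewrite -(ler_sqr _ _) ?nnegrE ?cabs_ge0 ?sqrtr_ge0 //
  [leRHS]sqr_sqrtr ?l2sq_ge0 // cabs2_le_l2sq.
Qed.

(** A unit vector that is optimal for [M] is used as a test vector for [M']; the squares are then
    compared coordinate by coordinate. *)
Lemma gram_eta_step n (M M' : 'M[R[i]]_n) (l : R) : (0 < n)%N ->
  mxsum1 (M' - M) <= l ->
  Defs.eta (ctr M' *m M') n <=
    Defs.eta (ctr M *m M) n + 2 * n%:R * l * Num.sqrt (Defs.eta (ctr M *m M) n) + n%:R * l ^+ 2.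
Proof.
move=> n0 Ml; have [v v1 vE] := eta_attained M n0.
have := eta_le_l2sq M' v; rewrite v1 mulr1 => /le_trans; apply.
set a := Num.sqrt _.
have a0 : 0 <= a by exact: sqrtr_ge0.
have l0 : 0 <= l by apply: le_trans Ml; exact: mxsum1_ge0.
have va i : cabs ((M *m v) i 0) <= a by rewrite /a -vE; exact: cabs_le_sqrt_l2sq.
have w i : cabs (((M' - M) *m v) i 0) <= l.
  apply: le_trans Ml; rewrite mxE; apply: (le_trans (ler_cabs_sum _ _ _)).
  apply: (@le_trans _ _ (\sum_j cabs ((M' - M) i j))).
    apply: ler_sum => j _; rewrite cabsM ler_piMr ?cabs_ge0 //.
    by have := cabs_le_sqrt_l2sq v j; rewrite v1 sqrtr1.
  rewrite /mxsum1 [leRHS](bigD1 i) //= lerDl.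
  by do 2 apply: sumr_ge0 => ? _; exact: cabs_ge0.
apply: (@le_trans _ _ (\sum_(i < n) (cabs ((M *m v) i 0) ^+ 2 + (2 * l * a + l ^+ 2)))).
  apply: ler_sum => i _.
  have -> : M' *m v = M *m v + (M' - M) *m v by rewrite mulmxBl addrC subrK.
  rewrite mxE.
  have := ler_cabsD ((M *m v) i 0) (((M' - M) *m v) i 0).
  move: (va i) (w i) (cabs_ge0 ((M *m v) i 0)) (cabs_ge0 (((M' - M) *m v) i 0)).
  set x := cabs ((M *m v) i 0); set y := cabs _; move=> xa yl x0 y0 t.
  apply: (@le_trans _ _ ((x + l) ^+ 2)).
    by rewrite ler_sqr ?nnegrE ?cabs_ge0 ?addr_ge0 // (le_trans t) // lerD2l.
  by have := ler_wpM2l l0 xa; lra.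
rewrite big_split /= -/(l2sq _) vE sumr_const card_ord -mulr_natl.
lra.
Qed.

(** Here [a] and [b] stand for the two smallest singular values and [N] for the dimension. The first
    inequality gives [b <= N * (a + l)], which removes [b] from the second. *)
Lemma sqr_dist_le (N l a b : R) : 1 <= N -> 0 <= l -> 0 <= a -> 0 <= b ->
  b ^+ 2 <= a ^+ 2 + 2 * N * l * a + N * l ^+ 2 ->
  a ^+ 2 <= b ^+ 2 + 2 * N * l * b + N * l ^+ 2 ->
  `|b ^+ 2 - a ^+ 2| <= 3 * N ^+ 2 * l * (a + l).
Proof.
move=> N1 l0 a0 b0 H1 H2.
have la : 0 <= l * a by rewrite mulr_ge0.
have ll : 0 <= l * l by rewrite mulr_ge0.
have NN : N <= N ^+ 2 by rewrite expr2 ler_peMl // (le_trans ler01).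
have hb : b <= N * (a + l).
  rewrite -(ler_sqr _ _) ?nnegrE ?mulr_ge0 ?addr_ge0 // ?(le_trans ler01) //.
  have h1 := ler_wpM2r la NN; have h2 := ler_wpM2r ll NN.
  have h3 : a ^+ 2 <= N ^+ 2 * a ^+ 2 by rewrite ler_peMl ?sqr_ge0 // (le_trans N1).
  lra.
have h4 : N * l * b <= N * l * (N * (a + l)).
  by rewrite ler_wpM2l // mulr_ge0 // (le_trans ler01).
have h1 := ler_wpM2r la NN; have h2 := ler_wpM2r ll NN.
have h5 : 0 <= N ^+ 2 * (l * a) by rewrite mulr_ge0 ?sqr_ge0.
have h6 : 0 <= N ^+ 2 * (l * l) by rewrite mulr_ge0 ?sqr_ge0.
rewrite ler_norml; apply/andP; split; lra.
Qed.

(** The factor [Num.sqrt] on the right is the point: where the smallest singular value is small, its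
    square varies slowly. *)
Lemma gram_eta_lipschitz n (M M' : 'M[R[i]]_n) (l : R) : (0 < n)%N ->
  mxsum1 (M' - M) <= l ->
  `|Defs.eta (ctr M' *m M') n - Defs.eta (ctr M *m M) n| <=
    3 * n%:R ^+ 2 * l * (Num.sqrt (Defs.eta (ctr M *m M) n) + l).
Proof.
move=> n0 Ml; have l0 : 0 <= l by apply: le_trans Ml; exact: mxsum1_ge0.
have H1 := gram_eta_step n0 Ml.
have := @gram_eta_step _ M' M l n0; rewrite -mxsum1N opprB => /(_ Ml) H2.
move: H1 H2 (gram_eta_ge0 M n0) (gram_eta_ge0 M' n0).
move: (Defs.eta (ctr M *m M) n) (Defs.eta (ctr M' *m M') n) => x y H1 H2 x0 y0.
have := @sqr_dist_le n%:R l (Num.sqrt x) (Num.sqrt y).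
by rewrite ler1n !sqrtr_ge0 !sqr_sqrtr //; apply.
Qed.

End EtaPerturbation.

(** * A rational matrix function [T = N / chi] near a point [c] where the denominator does not
    vanish *)

Section DegenerateDeterminant.
Variable R : realType.
Variables (n : nat) (N : 'M[{poly R[i]}]_n) (chi : {poly R[i]}).
Variables (T : R[i] -> 'M[R[i]]_n) (c : R[i]).
Hypothesis chi_neq0 : chi.[c] != 0.
Hypothesis NE : forall s, chi.[s] != 0 -> mxev N s = chi.[s] *: T s.

Lemma quotient_lipschitz : exists2 d : R, 0 < d <= 1 & exists2 L : R, 0 <= L &
  forall x y, cabs (x - c) <= d -> cabs (y - c) <= d ->
  mxsum1 (T x - T y) <= L * cabs (x - y).
Proof using chi_neq0 NE.
have [d /andP[d0 d1] [m m0 Hm]] := horner_neq0_near chi_neq0.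
have [M M0 HM] := mxev_lipschitz N c.
have [K K0 HK] := horner_lipschitz chi c.
exists d; first by rewrite d0.
exists (m^-1 * M + m^-1 * m^-1 * K * M) => [|x y xd yd].
  have := ltW m0; rewrite -invr_ge0 => m0'.
  by rewrite addr_ge0 // !mulr_ge0.
have mx := Hm _ xd; have my := Hm _ yd.
have x0 : chi.[x] != 0 by rewrite -cabs_gt0 (lt_le_trans m0).
have y0 : chi.[y] != 0 by rewrite -cabs_gt0 (lt_le_trans m0).
have xm : (cabs chi.[x])^-1 <= m^-1 by rewrite lef_pV2 ?posrE // (lt_le_trans m0).
have ym : (cabs chi.[y])^-1 <= m^-1 by rewrite lef_pV2 ?posrE // (lt_le_trans m0).
have [_ H1] := HM _ _ (le_trans xd d1) (le_trans yd d1).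
have [H2 _] := HM _ _ (le_trans yd d1) (le_trans xd d1).
have [_ H3] := HK _ _ (le_trans yd d1) (le_trans xd d1).
(* The quotient difference splits into a variation of the numerator and a variation of the
   denominator. *)
have -> : T x - T y = chi.[x]^-1 *: (mxev N x - mxev N y)
    + (chi.[x]^-1 * chi.[y]^-1 * (chi.[y] - chi.[x])) *: mxev N y.
  rewrite !NE // scalerBr !scalerA mulVf // scale1r.
  apply/matrixP => i j; rewrite !mxE.
  by field; rewrite x0 y0.
apply: (le_trans (mxsum1D _ _)); rewrite !mxsum1Z !cabsM !cabsV mulrDl; apply: lerD.
  rewrite -mulrA; apply: ler_pM => //; rewrite ?invr_ge0 ?cabs_ge0 ?mxsum1_ge0 //.
rewrite -[leRHS]mulrA [M * _]mulrC mulrA; apply: ler_pM => //; rewrite ?mxsum1_ge0 //.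
  by rewrite !mulr_ge0 ?invr_ge0 ?cabs_ge0.
rewrite -[leRHS]mulrA; apply: ler_pM => //; rewrite ?mulr_ge0 ?invr_ge0 ?cabs_ge0 //.
  by apply: ler_pM; rewrite ?invr_ge0 ?cabs_ge0.
by rewrite (cabsC x y).
Qed.

(* A column of the adjugate of [N] is a nonvanishing vector field [v] with
   [N v = det N e_j], which makes the smallest singular value of [T] as small
   as [det N]. *)
Lemma sqrt_eta_le_det : (n.-1 <= \rank (T c))%N -> (0 < n)%N ->
  exists2 d : R, 0 < d <= 1 & exists2 K : R, 0 <= K &
  forall s, cabs (s - c) <= d ->
  Num.sqrt (eta_of T n s) <= K * cabs (\det N).[s].
Proof using chi_neq0 NE.
move=> rT n0.
(* The rank hypothesis gives a nonzero adjugate entry at [c]; its column [j] supplies the vector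
   field, and row [i] keeps it away from zero nearby. *)
have [i [j aij]] : exists i j, (\adj (mxev N c)) i j != 0.
  have : \adj (mxev N c) != 0.
    by apply: adj_neq0 => //; rewrite NE // mxrank_scale_nz.
  move=> /negP a0; apply: contrapT => H; apply: a0; apply/eqP/matrixP => i j.
  by rewrite [RHS]mxE; apply/eqP/negPn/negP => H'; apply: H; exists i, j.
pose w := (\adj N) i j.
have w0 : w.[c] != 0 by move: aij; rewrite -mxev_adj mxE.
have [d /andP[d0 d1] [m m0 Hm]] := horner_neq0_near chi_neq0.
have [d' /andP[d'0 d'1] [m' m'0 Hm']] := horner_neq0_near w0.
exists (Num.min d d').
  by rewrite lt_min d0 d'0 ge_min d1.
exists (m'^-1 * m^-1) => [|s]; first by rewrite mulr_ge0 ?invr_ge0 ?ltW.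
rewrite le_min => /andP[/Hm sd /Hm' sd'].
have s0 : chi.[s] != 0 by rewrite -cabs_gt0 (lt_le_trans m0).
pose v := \adj (mxev N s) *m delta_mx j (0 : 'I_1).
have Tv : T s *m v = (chi.[s]^-1 * (\det N).[s]) *: delta_mx j 0.
  rewrite -scalerA -det_mxev -[\det _ *: _]mul_scalar_mx -mul_mx_adj.
  rewrite -mulmxA -/v {1}NE //.
  by rewrite -!scalemxAl scalerA mulVf // scale1r.
have vm : m' ^+ 2 <= l2sq v.
  have vi : v i 0 = w.[s] by rewrite /v -colE mxE -mxev_adj mxE.
  apply: le_trans (cabs2_le_l2sq v i); rewrite vi.
  by rewrite ler_sqr ?nnegrE ?cabs_ge0 ?(ltW m'0).
have := eta_le_l2sq (T s) v; rewrite -/(eta_of T n s) Tv l2sqZ.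
have -> : l2sq (delta_mx j (0 : 'I_1) : 'cV[R[i]]_n) = 1.
  rewrite /l2sq (bigD1 j) //= mxE !eqxx cabs1 expr1n big1 ?addr0 // => l /negbTE lj.
  by rewrite mxE lj cabs0 expr0n.
rewrite mulr1 => H.
have e0 : 0 <= eta_of T n s by exact: gram_eta_ge0.
have {}H : Num.sqrt (eta_of T n s) * m' <= cabs (chi.[s]^-1 * (\det N).[s]).
  rewrite -(ler_sqr _ _) ?nnegrE ?cabs_ge0 ?mulr_ge0 ?sqrtr_ge0 ?(ltW m'0) //.
  rewrite exprMn (sqr_sqrtr e0); apply: le_trans H.
  exact: (ler_wpM2l e0 vm).
rewrite -mulrA ler_pdivlMl // mulrC (le_trans H) // cabsM cabsV.
by rewrite ler_wpM2r ?cabs_ge0 // lef_pV2 ?posrE // (lt_le_trans m0).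
Qed.

(** A double zero of [\det N] makes the smallest singular value of order [cabs (y - c) ^+ 2].
    Through [gram_eta_lipschitz] this factor enters the increments of [eta], as [hessian_eq0]
    requires. *)
Lemma hessian_eta_eq0 q : (n.-1 <= \rank (T c))%N -> (0 < n)%N ->
  \det N = q * ('X - c%:P) ^+ 2 -> hessian (eta_of T n) c = 0.
Proof using chi_neq0 NE.
move=> rT n0 dN.
have [d /andP[d0 d1] [L L0 HL]] := quotient_lipschitz.
have [d' /andP[d'0 d'1] [K K0 HK]] := sqrt_eta_le_det rT n0.
have [Q Q0 HQ] := horner_lipschitz q c.
have KQ : 0 <= K * Q + L by rewrite addr_ge0 // mulr_ge0.
(* Halving [d] keeps [z] within [d] of [c] by the triangle inequality through [y]. *)
apply: (@hessian_eq0 _ _ _ (3 * n%:R ^+ 2 * L * (K * Q + L)) (Num.min (d / 2) d')).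
- by rewrite lt_min divr_gt0.
- by rewrite !mulr_ge0 // ler0n.
move=> y z; rewrite !lt_min => /andP[yd yd'] /andP[zd _].
have zc : cabs (z - c) <= d.
  have := ler_cabsD (z - y) (y - c); rewrite subrKA; lra.
have yc : cabs (y - c) <= d by lra.
have Tl := HL _ _ zc yc.
have /le_trans := gram_eta_lipschitz n0 Tl; apply.
have yq : Num.sqrt (eta_of T n y) <= K * Q * cabs (y - c) ^+ 2.
  apply: le_trans (HK y (ltW yd')) _; rewrite -mulrA ler_wpM2l //.
  rewrite dN hornerM horner_exp hornerXsubC cabsM cabsX ler_wpM2r ?sqr_ge0 //.
  by have [] := HQ y y (le_trans yc d1) (le_trans yc d1).
rewrite -/(eta_of T n y).
have zy0 := cabs_ge0 (z - y).
apply: (@le_trans _ _ (3 * n%:R ^+ 2 * (L * cabs (z - y)) *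
   ((K * Q + L) * (cabs (y - c) ^+ 2 + cabs (z - y))))).
  apply: ler_wpM2l; first by rewrite !mulr_ge0 // ler0n.
  have := mulr_ge0 L0 (sqr_ge0 (cabs (y - c))).
  have := mulr_ge0 (mulr_ge0 K0 Q0) zy0.
  lra.
by rewrite le_eqVlt; apply/orP; left; apply/eqP; ring.
Qed.

End DegenerateDeterminant.

(** * The reduced transfer function *)

Lemma oppmx_unit (F : fieldType) n (M : 'M[F]_n) : (- M \in unitmx) = (M \in unitmx).
Proof. by rewrite -scaleN1r unitmxZ // unitfE oppr_eq0 oner_eq0. Qed.

(** * Inverses bounded uniformly in the subspaces *)

Section InverseBounds.
Variable R : realType.

(** The Rayleigh bound makes [X] injective; applied to the columns of the inverse, it bounds each of
    the [n * n] entries by [xi^-1]. *)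
Lemma sigma_min_inv n (X : 'M[R[i]]_n) (xi : R) : 0 < xi -> xi <= sigma_min X ->
  X \in unitmx /\ mxsum1 (invmx X) <= (n * n)%:R * xi^-1.
Proof.
move=> xi0 H.
have le_X (v : 'cV[R[i]]_n) : xi ^+ 2 * l2sq v <= l2sq (X *m v).
  apply: le_trans (eta_le_l2sq X v); rewrite ler_wpM2r ?l2sq_ge0 //.
  (* [Num.sqrt] is [0] on negative numbers, so a positive root already forces a positive [eta]. *)
  have e0 : 0 <= Defs.eta (ctr X *m X) n.
    by rewrite ltW // -sqrtr_gt0 (lt_le_trans xi0).
  by rewrite -[leRHS](sqr_sqrtr e0) ler_sqr ?nnegrE ?sqrtr_ge0 // ltW.
have Xu : X \in unitmx.
  rewrite unitmxE unitfE; apply/eqP => /det0_cVP[v v0 Xv].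
  move/negP: v0; apply; apply/eqP/l2sq_eq0/eqP.
  have := le_X v; rewrite Xv [X in _ <= X](_ : _ = 0); last first.
    by rewrite /l2sq big1 // => i _; rewrite mxE cabs0 expr0n.
  rewrite pmulr_rle0 ?exprn_gt0 // => H'.
  by rewrite eq_le H' l2sq_ge0.
split=> //; apply: mxsum1_le => i j.
have := le_X (invmx X *m delta_mx j 0).
rewrite mulKVmx // -colE [X in _ <= X](_ : _ = 1); last first.
  rewrite /l2sq (bigD1 j) //= mxE !eqxx cabs1 expr1n big1 ?addr0 // => l /negbTE lj.
  by rewrite mxE lj cabs0 expr0n.
move=> H1; rewrite -[leRHS]mul1r ler_pdivlMr // mulrC.
rewrite -(ler_sqr _ _) ?nnegrE ?mulr_ge0 ?cabs_ge0 ?(ltW xi0) // expr1n.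
apply: le_trans H1; rewrite exprMn ler_wpM2l ?sqr_ge0 //.
have := cabs2_le_l2sq (col j (invmx X)) i.
by rewrite [X in cabs X]mxE.
Qed.

(** Entries of unit columns have modulus at most one, and orthonormality forces [r <= k]; the bound
    is thus independent of the reduced dimension. *)
Lemma orthonormal_mxsum1 k r (V : 'M[R[i]]_(k, r)) : orthonormal_cols V ->
  mxsum1 V <= (k * k)%:R.
Proof.
move=> VV; have rk : (r <= k)%N.
  have := mxrankM_maxr (ctr V) V; rewrite VV mxrank1 => /leq_trans; apply.
  exact: rank_leq_row.
apply: (@le_trans _ _ ((k * r)%:R * 1)); last first.
  by rewrite mulr1 ler_nat leq_mul2l rk orbT.
apply: mxsum1_le => i j.
have : l2sq (col j V) = 1.
  apply: complexI; rewrite l2sq_ctr.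
  have -> : ctr (col j V) *m col j V = \matrix_(_, _) ((ctr V *m V) j j).
    by apply/matrixP => a b; rewrite !mxE; apply: eq_bigr => l _; rewrite !mxE.
  by rewrite VV !mxE eqxx.
move=> V1; have := cabs_le_sqrt_l2sq (col j V) i.
by rewrite V1 sqrtr1 mxE.
Qed.

(** The inverse [X] solves [X = D^-1 - t D^-1 F X]; the last term has at most half the norm of [X]
    and is absorbed. *)
Lemma mxsum1_inv_perturb n (D F : 'M[R[i]]_n) (t : R[i]) (a b : R) :
  D \in unitmx -> D + t *: F \in unitmx ->
  mxsum1 (invmx D) <= a -> mxsum1 F <= b -> cabs t * (a * b) <= 1 / 2 ->
  mxsum1 (invmx (D + t *: F)) <= 2 * a.
Proof.
move=> Du DFu Da Fb tab; set X := invmx _.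
have XE : X = invmx D - t *: (invmx D *m F *m X).
  have : invmx D *m ((D + t *: F) *m X) = invmx D by rewrite mulmxV // mulmx1.
  rewrite mulmxDl mulmxDr mulKmx // => E.
  by rewrite -{1}E -scalemxAl -scalemxAr mulmxA addrK.
have := mxsum1B (invmx D) (t *: (invmx D *m F *m X)); rewrite -XE mxsum1Z => H.
have X0 := mxsum1_ge0 X.
have : cabs t * mxsum1 (invmx D *m F *m X) <= 1 / 2 * mxsum1 X.
  apply: le_trans (ler_wpM2r X0 tab); rewrite -mulrA ler_wpM2l ?cabs_ge0 //.
  apply: (le_trans (mxsum1M _ _)); rewrite ler_wpM2r //.
  by apply: (le_trans (mxsum1M _ _)); rewrite ler_pM ?mxsum1_ge0.
lra.
Qed.

End InverseBounds.

(** * Polynomial numerator of the transfer function and the interpolation error *)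

Section TransferFunction.
Variable R : realType.
Variables (n k d : nat) (Pc : 'I_d.+1 -> 'M[R[i]]_n) (A : 'M[R[i]]_k).
Variables (B : 'M[R[i]]_(k, n)) (Cm : 'M[R[i]]_(n, k)).

(** The numerator of [tf] over the common denominator [char_poly A], by Cramer's rule for the
    resolvent. *)
Definition tf_num : 'M[{poly R[i]}]_n :=
  char_poly A *: (\sum_(j < d.+1) 'X ^+ j *: map_mx polyC (Pc j))
  + map_mx polyC Cm *m \adj (char_poly_mx A) *m map_mx polyC B.

Lemma mxev_polyC p q (M : 'M[R[i]]_(p, q)) s : mxev (map_mx polyC M) s = M.
Proof. by apply/matrixP => i j; rewrite !mxE /horner_eval hornerC. Qed.

Lemma mxev_char_poly_mx s : mxev (char_poly_mx A) s = s%:M - A.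
Proof.
apply/matrixP => i j; rewrite !mxE /horner_eval !hornerE.
by rewrite hornerMn hornerX.
Qed.

Lemma horner_char_poly s : (char_poly A).[s] = \det (s%:M - A).
Proof. by rewrite -mxev_char_poly_mx det_mxev. Qed.

Lemma resolvent_adj s : (char_poly A).[s] != 0 ->
  s%:M - A \in unitmx /\
  invmx (s%:M - A) = (char_poly A).[s]^-1 *: mxev (\adj (char_poly_mx A)) s.
Proof.
move=> s0; have u : s%:M - A \in unitmx by rewrite unitmxE unitfE -horner_char_poly.
by split=> //; rewrite mxev_adj mxev_char_poly_mx /invmx u horner_char_poly.
Qed.

Lemma mxev_tf_num s : (char_poly A).[s] != 0 ->
  mxev tf_num s = (char_poly A).[s] *: tf Pc A B Cm s.
Proof.
move=> s0; have [_ E] := resolvent_adj s0.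
rewrite /tf E scalerDr -scalemxAr -scalemxAl scalerA divff // scale1r.
rewrite /mxev /tf_num map_mxD !map_mxM /= -!/(mxev _ _) !mxev_polyC.
congr (_ + _); rewrite /mxev map_mxZ /= /horner_eval; congr (_ *: _).
rewrite (map_mx_sum (horner_eval s)); apply: eq_bigr => j _.
rewrite map_mxZ /= -/(mxev _ _) mxev_polyC /horner_eval.
by rewrite hornerXn.
Qed.

(* The residual [K^-1 - V D^-1 W^H] is annihilated by [W^H K] on the left and
   by [K V] on the right, so [C] and [B] each contribute a factor [lam - s]. *)
Lemma interp_error r (V W : 'M[R[i]]_(k, r)) (lam s : R[i]) (q : nat) :
  (0 < q)%N -> interp_subspaces q A B Cm V W lam ->
  lam%:M - A \in unitmx -> s%:M - A \in unitmx ->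
  s *: (ctr W *m V) - ctr W *m A *m V \in unitmx ->
  tf Pc A B Cm s - rtf Pc A B Cm V W s =
  (s - lam) ^+ 2 *: (Cm *m invmx (lam%:M - A) *m
    (invmx (s%:M - A) - V *m invmx (s *: (ctr W *m V) - ctr W *m A *m V) *m ctr W)
    *m (invmx (lam%:M - A) *m B)).
Proof.
move=> q0 /(_ 1%N); rewrite q0 => /(_ isT); rewrite !expr1 /Defs.colsub.
set Kl := lam%:M - A; set K := s%:M - A; set D := _ - ctr W *m A *m V.
move=> [/submxP[Z /(congr1 trmx)] + /submxP[Y /(congr1 trmx)] +] Klu Ku Du.
rewrite !trmxK !trmx_mul !trmxK => BE CE.
have AE : A - lam%:M = - Kl by rewrite opprB.
(* The interpolation blocks of exponent one put [invmx Kl *m B] in the range of [V], and dually for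
   [Cm] and [W]; the sign comes from [A - lam%:M = - Kl]. *)
have Bv : invmx Kl *m B = - (V *m Z^T).
  have AEu : A - lam%:M \in unitmx by rewrite AE oppmx_unit.
  by rewrite -[B](mulKVmx AEu) BE AE mulNmx mulmxN mulKmx.
have Cw : Cm *m invmx Kl = - (ctr Y^T *m ctr W).
  have cu : ctr (A - lam%:M) \in unitmx.
    by rewrite /ctr unitmx_tr map_unitmx AE oppmx_unit.
  rewrite -[Cm]ctrK -[ctr Cm](mulKVmx cu) CE !ctrM ctrK AE.
  by rewrite mulmxN mulNmx mulmxK.
have DE : D = ctr W *m K *m V.
  by rewrite /K mulmxBr mulmxBl mul_mx_scalar -scalemxAl.
set T := invmx K - _.
have WT : ctr W *m K *m T = 0.
  rewrite (mulmxBr (ctr W *m K)) mulmxK //.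
  by rewrite !mulmxA -DE mulmxV // mul1mx subrr.
have TV : T *m K *m V = 0.
  rewrite (mulmxBl (invmx K)) mulVmx // mulmxBl mul1mx.
  by rewrite -!mulmxA (mulmxA (ctr W)) -DE mulVmx // mulmx1 subrr.
have KlE : Kl = K + (lam - s)%:M.
  by rewrite raddfB addrC addrA subrK.
(* Inserting [Kl = K + (lam - s)%:M] after [Cm *m invmx Kl], the [K] part meets
   [ctr W *m K *m T = 0] and only the scalar part survives. *)
have CT : Cm *m T = (lam - s) *: (Cm *m invmx Kl *m T).
  rewrite -[in LHS](mulmxKV Klu Cm) [in X in _ *m X *m T]KlE.
  rewrite (mulmxDr _ K) mulmxDl mul_mx_scalar -scalemxAl.
  by rewrite {1}Cw !mulNmx -!mulmxA (mulmxA (ctr W)) WT mulmx0 oppr0 add0r.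
have TB : T *m B = (lam - s) *: (T *m (invmx Kl *m B)).
  rewrite -[in LHS](mulKVmx Klu B) [X in T *m (X *m (_ *m B))]KlE.
  rewrite (mulmxDl K) mulmxDr mul_scalar_mx -scalemxAr.
  by rewrite {1}Bv !mulmxN !mulmxA TV mul0mx oppr0 add0r.
have -> : tf Pc A B Cm s - rtf Pc A B Cm V W s = Cm *m T *m B.
  rewrite /tf /rtf opprD addrACA subrr add0r /T mulmxBr mulmxBl.
  by rewrite !mulmxA.
rewrite CT -scalemxAl -mulmxA TB -!scalemxAr scalerA mulmxA.
by rewrite -expr2 -sqrrN opprB !mulmxA.
Qed.

End TransferFunction.

(** The factors in [interp_error] are bounded by constants fixed before [r], [V] and [W]: the full
    resolvent by its adjugate formula near [c], the reduced one by [xi] at [c] and a perturbation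
    from [c] to [s]. *)
Lemma interp_error_bound (R : realType) (n k d q : nat)
  (Pc : 'I_d.+1 -> 'M[R[i]]_n) (A : 'M[R[i]]_k) (B : 'M[R[i]]_(k, n))
  (Cm : 'M[R[i]]_(n, k)) (c : R[i]) (xi : R) :
  (0 < q)%N -> 0 < xi -> (char_poly A).[c] != 0 ->
  exists2 e : R, 0 < e <= 1 & exists2 E : R, 0 <= E &
  forall (r : nat) (V W : 'M[R[i]]_(k, r)) (lam s : R[i]),
    orthonormal_cols V -> orthonormal_cols W ->
    interp_subspaces q A B Cm V W lam ->
    xi <= sigma_min (ctr W *m A *m V - c *: (ctr W *m V)) ->
    cabs (lam - c) < e -> cabs (s - c) < e ->
    s *: (ctr W *m V) - ctr W *m A *m V \in unitmx ->
    (char_poly A).[s] != 0 /\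
    mxsum1 (tf Pc A B Cm s - rtf Pc A B Cm V W s) <= E * cabs (s - lam) ^+ 2.
Proof.
move=> q0 xi0 chi0.
have [e /andP[e0 e1] [m m0 Hm]] := horner_neq0_near chi0.
have [M M0 HM] := mxev_lipschitz (\adj (char_poly_mx A)) c.
pose kk : R := (k * k)%:R.
pose a := kk * xi^-1; pose b := kk * kk.
have kk0 : 0 <= kk by exact: ler0n.
have a0 : 0 <= a by rewrite mulr_ge0 // invr_ge0 ltW.
have b0 : 0 <= b by rewrite mulr_ge0.
have ab1 : 0 < 2 * (a * b + 1) by rewrite mulr_gt0 // ltr_wpDl // mulr_ge0.
pose K := m^-1 * M.
have K0 : 0 <= K by rewrite mulr_ge0 // invr_ge0 ltW.
(* The second radius gives [cabs (s - c) * (a * b) <= 1 / 2], the smallness needed by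
   [mxsum1_inv_perturb]. *)
exists (Num.min e (2 * (a * b + 1))^-1).
  by rewrite lt_min e0 invr_gt0 ab1 ge_min e1.
exists (mxsum1 Cm * K * (K + kk * (2 * a) * kk) * (K * mxsum1 B)).
  by do ?[apply: mulr_ge0 | apply: addr_ge0 | exact: mxsum1_ge0
         | exact: ler0n | rewrite invr_ge0 ltW].
move=> r V W lam s VV WW VWi VWs; rewrite !lt_min => /andP[le _] /andP[se sab] Du.
have inv_le x : cabs (x - c) < e -> x%:M - A \in unitmx /\ mxsum1 (invmx (x%:M - A)) <= K.
  move=> xe; have mx := Hm x (ltW xe).
  have x0 : (char_poly A).[x] != 0 by rewrite -cabs_gt0 (lt_le_trans m0).
  have [u ->] := resolvent_adj x0; split=> //.
  rewrite mxsum1Z cabsV; apply: ler_pM; rewrite ?invr_ge0 ?cabs_ge0 ?mxsum1_ge0 //.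
    by rewrite lef_pV2 ?posrE // (lt_le_trans m0).
  have x1 : cabs (x - c) <= 1 by rewrite (le_trans (ltW xe)).
  by have [] := HM x x x1 x1.
have [lu lK] := inv_le _ le; have [su sK] := inv_le _ se.
have s0 : (char_poly A).[s] != 0 by rewrite -cabs_gt0 (lt_le_trans m0) // Hm // ltW.
split=> //.
rewrite (interp_error Pc q0 VWi lu su Du) mxsum1Z cabsX mulrC.
rewrite ler_wpM2r ?sqr_ge0 //.
have Vk := orthonormal_mxsum1 VV; have Wk := orthonormal_mxsum1 WW.
have rk : (r <= k)%N.
  have := mxrankM_maxr (ctr V) V; rewrite VV mxrank1 => /leq_trans; apply.
  exact: rank_leq_row.
set D := s *: (ctr W *m V) - ctr W *m A *m V in Du *.
have DK : mxsum1 (invmx D) <= 2 * a.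
  have [Xu Xa] := sigma_min_inv xi0 VWs.
  set X := ctr W *m A *m V - c *: (ctr W *m V) in Xu Xa.
  have DE : - D = X + (- (s - c)) *: (ctr W *m V).
    by rewrite /D /X opprB opprB scalerBl addrA subrK.
  have -> : mxsum1 (invmx D) = mxsum1 (invmx (- D)).
    rewrite -scaleN1r invmxZ ?scaleN1r ?oppmx_unit //.
    by rewrite invrN1 scaleN1r mxsum1N.
  rewrite DE; apply: (@mxsum1_inv_perturb _ _ _ _ _ a b) => //.
  - by rewrite -DE oppmx_unit.
  - apply: le_trans Xa _; rewrite ler_wpM2r ?invr_ge0 ?(ltW xi0) //.
    by rewrite ler_nat leq_mul.
  - by apply: (le_trans (mxsum1M _ _)); rewrite mxsum1_ctr ler_pM ?mxsum1_ge0.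
  rewrite cabsN; have := ltW sab; rewrite -[X in _ <= X]mul1r ler_pdivlMr // => H.
  have := cabs_ge0 (s - c); lra.
have TK : mxsum1 (invmx (s%:M - A) - V *m invmx D *m ctr W) <= K + kk * (2 * a) * kk.
  apply: (le_trans (mxsum1B _ _)); apply: lerD => //.
  apply: (le_trans (mxsum1M _ _)); rewrite mxsum1_ctr.
  apply: ler_pM; rewrite ?mxsum1_ge0 //.
  by apply: (le_trans (mxsum1M _ _)); rewrite ler_pM ?mxsum1_ge0.
apply: (le_trans (mxsum1M _ _)); apply: ler_pM; rewrite ?mxsum1_ge0 //.
  apply: (le_trans (mxsum1M _ _)); apply: ler_pM; rewrite ?mxsum1_ge0 //.
  by apply: (le_trans (mxsum1M _ _)); rewrite ler_wpM2l ?mxsum1_ge0.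
by apply: (le_trans (mxsum1M _ _)); rewrite ler_wpM2r ?mxsum1_ge0.
Qed.

(** Multiplying by the adjugate gives [\det N *: u = \adj N *m Q *m u]; norms are taken and that of
    [u] is cancelled. *)
Lemma cabs_det_le (R : realType) n (N Q : 'M[R[i]]_n) (u : 'cV[R[i]]_n) :
  u != 0 -> N *m u = Q *m u -> cabs (\det N) <= mxsum1 (\adj N) * mxsum1 Q.
Proof.
move=> u0 E.
have up : 0 < mxsum1 u.
  rewrite lt_neqAle mxsum1_ge0 andbT eq_sym.
  by apply: contra_neq u0 => /mxsum1_eq0.
rewrite -(ler_pM2r up) -mxsum1Z -mul_scalar_mx -mul_adj_mx -mulmxA E.
apply: (le_trans (mxsum1M _ _)); rewrite -mulrA.
by rewrite ler_wpM2l ?mxsum1_ge0 ?mxsum1M.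
Qed.

(** * The quadratic estimate *)

Theorem theorem2p7 (R : realType) (n k d q : nat)
  (Pc : 'I_d.+1 -> 'M[R[i]]_n) (A : 'M[R[i]]_k) (B : 'M[R[i]]_(k, n))
  (Cm : 'M[R[i]]_(n, k)) (lamstar : R[i]) (xi : R) :
  (2 <= q)%N -> (0 < n)%N -> 0 < xi ->
  (* lamstar is a simple eigenvalue of R(s) = P(s) + C (sI - A)^{-1} B *)
  eta_of (tf Pc A B Cm) n lamstar = 0 ->
  (forall j : nat, (1 <= j < n)%N -> 0 < eta_of (tf Pc A B Cm) j lamstar) ->
  xi <= sigma_min (A - lamstar%:M) ->
  (* the Hessian of eta_n at lamstar is invertible *)
  hessian (eta_of (tf Pc A B Cm) n) lamstar \in unitmx ->
  exists2 delta : R, 0 < delta &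
  exists2 Cst : R, 0 < Cst &
  forall (r : nat) (V W : 'M[R[i]]_(k, r)) (lam lam' : R[i]),
    orthonormal_cols V -> orthonormal_cols W ->
    interp_subspaces q A B Cm V W lam ->
    xi <= sigma_min (ctr W *m A *m V - lamstar *: (ctr W *m V)) ->
    cabs (lam - lamstar) < delta ->
    cabs (lam' - lamstar) < delta ->
    rtf_eigenvalue Pc A B Cm V W lam' ->
    cabs (lam' - lamstar) <= Cst * cabs (lam - lamstar) ^+ 2.
Proof.
move=> q2 n0 xi0 eta0 etaj As Hu.
set c := lamstar in As Hu eta0 etaj *.
have chi0 : (char_poly A).[c] != 0.
  have [u _] := sigma_min_inv xi0 As.
  by rewrite horner_char_poly -unitfE -unitmxE -opprB oppmx_unit.
pose N := tf_num Pc A B Cm.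
have NE s : (char_poly A).[s] != 0 -> mxev N s = (char_poly A).[s] *: tf Pc A B Cm s.
  exact: mxev_tf_num.
have rT : (n.-1 <= \rank (tf Pc A B Cm c))%N by apply: rank_ge_pred.
have detc : (\det N).[c] = 0.
  have [v v1 vE] := eta_attained (tf Pc A B Cm c) n0.
  have Tv : tf Pc A B Cm c *m v = 0 by apply: l2sq_eq0; rewrite vE.
  rewrite -det_mxev; apply/eqP; apply: contraTT isT => dN /=.
  have Nu : mxev N c \in unitmx by rewrite unitmxE unitfE.
  have v0 : v = 0 by rewrite -(mulKmx Nu v) NE // -scalemxAl Tv scaler0 mulmx0.
  by have := oner_neq0 R; rewrite -v1 v0 /l2sq big1 ?eqxx // => i _; rewrite mxE cabs0 expr0n.
have /factor_theorem [p1 p1E] : root (\det N) c by apply/eqP.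
(* A second factor ['X - c%:P] would make the Hessian vanish, so invertibility makes [c] a simple
   zero of [\det N]. *)
have p10 : p1.[c] != 0.
  apply/negP => p1c.
  have /factor_theorem [p2 p2E] : root p1 c by [].
  have H0 : hessian (eta_of (tf Pc A B Cm) n) c = 0.
    apply: (hessian_eta_eq0 chi0 NE (q := p2)) => //.
    by rewrite p1E p2E -mulrA -expr2.
  by move: Hu; rewrite H0 unitmxE det0 unitr0.
have [d1 /andP[d10 d11] [m m0 Hm]] := horner_neq0_near p10.
have [e /andP[e0 e1] [E E0 HE]] := interp_error_bound Pc B Cm (ltnW q2) xi0 chi0.
have [M M0 HM] := mxev_lipschitz (\adj N) c.
have [X X0 HX] := horner_lipschitz (char_poly A) c.
pose K := M * X * E + 1.
have K0 : 0 < K by rewrite ltr_wpDl // !mulr_ge0.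
(* The radius [m / (4 * K)] gives [2 * K * x ^+ 2 <= m * x / 2], so half of [m * x] remains to be
   bounded by [2 * K * y ^+ 2]; hence the constant [4 * K / m]. *)
exists (Num.min (Num.min d1 e) (m / (4 * K))).
  by rewrite !lt_min d10 e0 divr_gt0 // mulr_gt0.
exists (4 * K / m); first by rewrite divr_gt0 // mulr_gt0.
move=> r V W lam lam' VV WW VWi VWs; rewrite !lt_min.
move=> /andP[/andP[_ le] _] /andP[/andP[ld le'] lK] [Du dR].
have [s0 HEs] := HE r V W lam lam' VV WW VWi VWs le le' Du.
have [u u0 Ru] := det0_cVP dR.
have l1 : cabs (lam' - c) <= 1 by rewrite (le_trans (ltW le')).
have [adjM _] := HM _ _ l1 l1; have [chiX _] := HX _ _ l1 l1.
(* On a kernel vector of the reduced function, the full one acts as the interpolation error. *)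
have EQ : mxev N lam' *m u =
    ((char_poly A).[lam'] *: (tf Pc A B Cm lam' - rtf Pc A B Cm V W lam')) *m u.
  by rewrite NE // -!scalemxAl mulmxBl Ru subr0.
have := cabs_det_le u0 EQ; rewrite mxsum1Z -mxev_adj det_mxev p1E hornerM hornerXsubC cabsM => H1.
set x := cabs (lam' - c) in H1 l1 lK *.
set y := cabs (lam - c).
have x0 : 0 <= x by exact: cabs_ge0.
have y0 : 0 <= y by exact: cabs_ge0.
set z := cabs (lam' - lam) in HEs.
have z0 : 0 <= z by exact: cabs_ge0.
have zxy : z <= x + y.
  by rewrite /z /x /y -(subrKA c) (cabsC lam c) ler_cabsD.
have H2 : m * x <= K * z ^+ 2.
  apply: (@le_trans _ _ (cabs p1.[lam'] * x)).
    by rewrite ler_wpM2r // Hm // ltW.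
  apply: (le_trans H1); apply: (@le_trans _ _ (M * (X * (E * z ^+ 2)))).
    apply: ler_pM; rewrite ?mxsum1_ge0 ?mulr_ge0 ?cabs_ge0 ?mxsum1_ge0 //.
    by apply: ler_pM; rewrite ?cabs_ge0 ?mxsum1_ge0.
  by rewrite /K; have := sqr_ge0 z; lra.
have H3 : z ^+ 2 <= 2 * x ^+ 2 + 2 * y ^+ 2.
  apply: (@le_trans _ _ ((x + y) ^+ 2)); first by rewrite ler_sqr ?nnegrE ?addr_ge0.
  by have := sqr_ge0 (x - y); lra.
have H4 := ler_wpM2l (ltW K0) H3.
move: lK; rewrite ltr_pdivlMr ?mulr_gt0 // => lK.
have H5 := ler_wpM2l x0 (ltW lK).
rewrite mulrAC ler_pdivlMr //.
lra.
Qed.
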